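(* Let $n\ge 3$ be an integer, and let $A$ be a nonsymmetric normal entry pattern of order $n$ with $k$ distinct entries. Then $k\le \frac{n(n-3)}{2}+3$, where equality holds if and only if $A$ is permutation similar to a pattern of the form $$ \left[\begin{array}{cccc|ccc} x_{11}&x_{12}&\cdots&x_{1,n-3}&y_1&y_1&y_1\\ x_{12}&x_{22}&\cdots&x_{2,n-3}&y_2&y_2&y_2\\ \vdots&\vdots&\ddots&\vdots&\vdots&\vdots&\vdots\\ x_{1,n-3}&x_{2,n-3}&\cdots&x_{n-3,n-3}&y_{n-3}&y_{n-3}&y_{n-3}\\ \hline y_1&y_2&\cdots&y_{n-3}&z&u&v\\ y_1&y_2&\cdots&y_{n-3}&v &z&u\\ y_1&y_2&\cdots&y_{n-3}&u&v &z \end{array}\right] $$ where $u,v,z$, $y_i$ ($1\le i\le n-3$), $x_{ij}$ ($1\le i\le j\le n-3$) are distinct indeterminates.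
   Context: An entry pattern of order $n$ is an $n\times n$ matrix each of whose entries is an indeterminate, where entries in different positions may be equal; that is, an element of $M_n\{x_1,\ldots,x_m\}$, the set of $n\times n$ matrices with entries from $\{x_1,\ldots,x_m\}$, for some distinct indeterminates $x_1,\ldots,x_m$. For an entry pattern $A$, $Q(A)$ denotes the set of real matrices obtained from $A$ by specifying real values for the indeterminates (equal indeterminates receive equal values; different indeterminates may receive equal or different values). A real square matrix $M$ is normal if $MM^T=M^TM$. A square entry pattern $A$ is called normal if every matrix in $Q(A)$ is normal. An entry pattern is nonsymmetric if $A\neq A^T$. Two square matrices $A,B$ of the same order are permutation similar if $B=P^TAP$ for some permutation matrix $P$. When $n=3$ the displayed pattern consists only of its lower right $3\times 3$ block. *)

(* Defs.v *)
From mathcomp Require Import all_boot all_order all_algebra all_fingroup.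
From mathcomp Require Import classical_sets reals.
Set Implicit Arguments.
Unset Strict Implicit.
Unset Printing Implicit Defensive.
Import GRing.Theory.

Local Open Scope ring_scope.
Local Open Scope classical_set_scope.

(* The elements of 'I_m stand for m distinct indeterminates. *)
Definition entry_pattern (m n : nat) := 'M['I_m]_n.

Definition num_entries (m n : nat) (A : entry_pattern m n) : nat :=
  #|[set A ij.1 ij.2 | ij : 'I_n * 'I_n]%SET|.

Definition realizations (R : realType) (m n : nat) (A : entry_pattern m n) :
    set 'M[R]_n :=
  range (fun v : 'I_m -> R => map_mx v A).

Definition normal_matrix (R : realType) (n : nat) (M : 'M[R]_n) : Prop :=
  M *m M^T = M^T *m M.

Definition normal_pattern (R : realType) (m n : nat) (A : entry_pattern m n) :
    Prop :=
  forall M : 'M[R]_n, realizations A M -> normal_matrix M.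

Definition nonsymmetric (m n : nat) (A : entry_pattern m n) : Prop :=
  A <> A^T.

(* P^T A P for P = perm_mx s, written without products so that it applies to
   matrices of indeterminates; perm_conjE gives the product over a semiring. *)
Definition perm_conj (T : Type) (n : nat) (s : 'S_n) (A : 'M[T]_n) : 'M[T]_n :=
  row_perm s^-1 (col_perm s^-1 A).

Lemma perm_conjE (S : pzSemiRingType) (n : nat) (s : 'S_n) (A : 'M[S]_n) :
  perm_conj s A = (perm_mx s)^T *m A *m perm_mx s.
Proof. by rewrite /perm_conj row_permE col_permE tr_perm_mx invgK mulmxA. Qed.

Definition perm_similar (m n : nat) (A B : entry_pattern m n) : Prop :=
  exists s : 'S_n, B = perm_conj s A.

(* Only the values x i j with i <= j are used. *)
Definition extremal_block (m p : nat) (x : 'I_p -> 'I_p -> 'I_m)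
    (y : 'I_p -> 'I_m) (z u v : 'I_m) : entry_pattern m (p + 3) :=
  block_mx
    (\matrix_(i < p, j < p) (if (i <= j)%N then x i j else x j i))
    (\matrix_(i < p, j < 3) y i)
    (\matrix_(i < 3, j < p) y j)
    (\matrix_(i < 3, j < 3)
       nth z (nth [::] [:: [:: z; u; v];
                           [:: v; z; u];
                           [:: u; v; z]] i) j).

Definition extremal_form (m n : nat) (B : entry_pattern m n) : Prop :=
  exists (p : nat) (e : (p + 3)%N = n)
         (x : 'I_p -> 'I_p -> 'I_m) (y : 'I_p -> 'I_m) (z u v : 'I_m),
    uniq ([:: u; v; z] ++ [seq y i | i : 'I_p] ++
          [seq x ij.1 ij.2 |
             ij in [pred ij : 'I_p * 'I_p | (ij.1 <= ij.2)%N]]) /\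
    B = castmx (e, e) (extremal_block x y z u v).

(* Main.v *)
Require Import Defs.
From mathcomp Require Import all_boot all_order all_algebra all_fingroup.
From mathcomp Require Import classical_sets reals.
(* fintype and finset come last: classical_sets shadows some of their names. *)
From mathcomp Require Import zify ring fintype finset.

(* Let T be the set of vertices lying on an asymmetric pair (A i j <> A j i).
   Normality, polarized, says that for a colour a that only occurs symmetrically
   the 0/1 matrix of a commutes with the skew part v(A) - v(A)^T of every
   realization v. Together with the fact that row i and column i carry the same
   multiset of colours, this shows that each colour of the block T x T occurs at
   least 3 times there. Hence 3 k_T <= t^2 with t = |T| >= 3 and k_T the number
   of colours in the block, and if t >= 4 the estimate improves to
   3 k_T + 2 <= t^2, because an asymmetric colour of weight 3 is a directed
   triangle and any further vertex of T then forces heavier colours. In both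
   cases k_T <= t(t-3)/2 + 3, with equality only for t = k_T = 3.
   For q outside T the same commutation makes a colour that is not in the
   T-block repeat along row q, so T contributes at most t - 2 new colours to
   row q. Adding the outside vertices one at a time, the i-th vertex contributes
   at most i - 2 new colours, which is the increment of i(i-3)/2 + 3. Equality
   forces t = 3, the circulant block on T, and rows q that are constant on T; the
   distinctness of the indeterminates then follows by counting. *)

Set Implicit Arguments.
Unset Strict Implicit.
Unset Printing Implicit Defensive.

Import GRing.Theory.

(** * Polarized normality and the arcs of a single colour *)

Section NormalPattern.

Context (R : realType) (m n : nat) (A : entry_pattern m n).
Hypothesis hnorm : normal_pattern R A.

(** Normality is quadratic in the realization: subtracting its instances at [v] and [w] from the one
    at [v + w] leaves the mixed terms. *)
Lemma normal_pattern_polar (i j : 'I_n) (v w : 'I_m -> R) :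
  (\sum_k (v (A i k) * w (A j k) + w (A i k) * v (A j k)) =
   \sum_k (v (A k i) * w (A k j) + w (A k i) * v (A k j)))%R.
Proof.
have H (u : 'I_m -> R) :
    (\sum_k u (A i k) * u (A j k) = \sum_k u (A k i) * u (A k j))%R.
  have := hnorm (ex_intro2 _ _ u I erefl).
  move=> /matrixP /(_ i j); rewrite !mxE.
  under eq_bigr do rewrite !mxE.
  by under [RHS]eq_bigr do rewrite !mxE.
have E (x y x' y' : R) :
    (x * y' + y * x' = (x + y) * (x' + y') - x * x' - y * y')%R by ring.
under eq_bigr do rewrite E.
under [RHS]eq_bigr do rewrite E.
by rewrite !sumrB (H v) (H w) (H (fun c => v c + w c)%R).
Qed.

(** Polarize the indicator of [a] against the constant 1, at a diagonal entry. *)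
Lemma row_col_balance (i : 'I_n) (a : 'I_m) :
  #|[set k | A i k == a]| = #|[set k | A k i == a]|.
Proof.
pose v c : R := (c == a)%:R%R.
have := normal_pattern_polar i i v (fun=> 1%R).
have E (x : R) : (x * 1 + 1 * x = x *+ 2)%R by ring.
under eq_bigr do rewrite E.
under [RHS]eq_bigr do rewrite E.
rewrite !sumrMnl -!natr_sum -!mulrnA => /eqP.
rewrite Num.Theory.eqr_nat eqn_pmul2r // => /eqP.
by rewrite -!sum1dep_card !(big_mkcond (fun _ => _ == _)).
Qed.

(* Entry (i, q) of the commutation of a with the skew part of a realization. *)
Lemma sym_color_step (a : 'I_m) (i p q : 'I_n) :
    (forall x y, A x y = a -> A y x = a) -> A i p != A p i -> A p q = a ->
  (exists k, [/\ k != p, A i k != A k i & A k q = a]) \/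
  (exists k, A i k = a /\ A q k != A k q).
Proof.
move=> a_sym ip pq.
case: (pickP (fun k => [&& k != p, A i k != A k i & A k q == a])).
  by move=> k /and3P[kp ik /eqP kq]; left; exists k.
move=> no1; case: (pickP (fun k => (A i k == a) && (A q k != A k q))).
  by move=> k /andP[/eqP ik qk]; right; exists k.
move=> no2; exfalso.
(* With both alternatives excluded, only the term [k = p] survives; it equals 1 for [v] the
   indicator of [A i p], but has to vanish. *)
pose v c : R := (c == A i p)%:R%R; pose w c : R := (c == a)%:R%R.
have symw x y : w (A x y) = w (A y x).
  by rewrite /w; congr (_%:R)%R; congr nat_of_bool; apply/eqP/eqP => /a_sym.
have := normal_pattern_polar i q v w; move/eqP; rewrite -subr_eq0 -sumrB.
have E k : (v (A i k) * w (A q k) + w (A i k) * v (A q k) -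
    (v (A k i) * w (A k q) + w (A k i) * v (A k q)) =
    (v (A i k) - v (A k i)) * w (A k q) +
    w (A i k) * (v (A q k) - v (A k q)))%R.
  by rewrite (symw q k) (symw k i); ring.
under eq_bigr do rewrite E.
rewrite big_split /= [X in (_ + X)%R]big1 => [|k _]; last first.
  have := no2 k; rewrite /w; case: eqP => // _ /=; last by rewrite mul0r.
  by move/negbFE/eqP => ->; rewrite subrr mulr0.
rewrite addr0 (bigD1 p) //= big1 => [|k kp]; last first.
  have := no1 k; rewrite kp /w; case: (A k q =P a); last by rewrite mulr0.
  by rewrite andbT /= => _ /negbFE/eqP ->; rewrite subrr mul0r.
rewrite /v /w pq !eqxx (eq_sym (A p i)) (negbTE ip).
by rewrite subr0 mulr1 addr0 oner_eq0.
Qed.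

(** Otherwise every out-neighbour of [j] in colour [a] would be an in-neighbour; by balance the two
    sets would coincide, yet [i] lies only in the second. *)
Lemma arc_next (a : 'I_m) (i j : 'I_n) : A i j = a -> A j i != a ->
  exists l, A j l = a /\ A l j != a.
Proof.
move=> ij ji.
case: (pickP (fun l => (A j l == a) && (A l j != a))) => [l|no].
  by case/andP=> /eqP jl lj; exists l.
have sub : [set k | A j k == a] \subset [set k | A k j == a].
  by apply/subsetP=> k; rewrite !inE => jk; have := no k; rewrite jk => /negbFE.
have /eqP/setP/(_ i) : [set k | A j k == a] == [set k | A k j == a].
  by rewrite eqEcard sub -row_col_balance leqnn.
by rewrite !inE ij eqxx (negbTE ji).
Qed.

Lemma arc_prev (a : 'I_m) (i j : 'I_n) : A i j = a -> A j i != a ->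
  exists l, A l i = a /\ A i l != a.
Proof.
move=> ij ji.
case: (pickP (fun l => (A l i == a) && (A i l != a))) => [l|no].
  by case/andP=> /eqP li il; exists l.
have sub : [set k | A k i == a] \subset [set k | A i k == a].
  by apply/subsetP=> k; rewrite !inE => jk; have := no k; rewrite jk => /negbFE.
have /eqP/setP/(_ j) : [set k | A k i == a] == [set k | A i k == a].
  by rewrite eqEcard sub row_col_balance leqnn.
by rewrite !inE ij eqxx (negbTE ji).
Qed.

(** * The asymmetric support and the weights of its colours *)

Definition asym_support : {set 'I_n} := [set i | [exists j, A i j != A j i]].
Local Notation T := asym_support.

Lemma mem_asym_support (i j : 'I_n) :
  A i j != A j i -> (i \in T) * (j \in T).
Proof.
move=> ij; split; rewrite inE; apply/existsP; first by exists j.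
by exists i; rewrite eq_sym.
Qed.

Lemma asym_neighbors (i : 'I_n) : i \in T ->
  exists k1 k2, [/\ k1 != k2, A i k1 != A k1 i & A i k2 != A k2 i].
Proof.
rewrite inE => /existsP[k ik].
have [l [li il]] := arc_prev erefl (introN eqP (nesym (elimN eqP ik))).
exists k, l; split=> //; first by apply: contraNneq il => <-.
by rewrite li.
Qed.

Definition colors (U : {set 'I_n}) : {set 'I_m} :=
  [set A ij.1 ij.2 | ij in setX U U].

Definition cells (a : 'I_m) : {set 'I_n * 'I_n} :=
  [set ij in setX T T | A ij.1 ij.2 == a].

Lemma mem_cells (a : 'I_m) (i j : 'I_n) :
  i \in T -> j \in T -> A i j = a -> (i, j) \in cells a.
Proof. by move=> iT jT ij; rewrite 2!inE /= iT jT ij eqxx. Qed.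

(** Two uses of [arc_next] prolong the arc to a walk [i, j, l, k] of asymmetric arcs, which stays
    inside the support. The end [k] may be [i]. *)
Lemma asym_color_cells (a : 'I_m) (i j : 'I_n) : A i j = a -> A j i != a ->
  exists l k, [/\ uniq [:: (i, j); (j, l); (l, k)],
    {subset [:: (i, j); (j, l); (l, k)] <= cells a}, l != i & l != j].
Proof.
move=> ij ji; have [l [jl lj]] := arc_next ij ji.
have [k [lk kl]] := arc_next jl lj.
have li : l != i by apply: contraNneq ji => <-; rewrite jl.
have nlj : l != j by apply: contraNneq lj => e; rewrite -jl e.
have nij : i != j by apply: contraNneq ji => e; rewrite -ij e.
exists l, k; split=> // [|x].
  by rewrite /= !inE !xpair_eqE !(negbTE nij) !(eq_sym j l) !(eq_sym i l)
    (negbTE nlj) (negbTE li).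
have mem x' y' : A x' y' = a -> A y' x' != a -> (x', y') \in cells a.
  move=> xy yx; have xyx : A x' y' != A y' x' by rewrite xy eq_sym.
  by have [xT yT] := mem_asym_support xyx; exact: mem_cells.
by rewrite !in_cons => /or4P[|||//] /eqP ->; exact: mem.
Qed.

Lemma leq_uniq_card (I : finType) (s : seq I) (B : {set I}) :
  uniq s -> {subset s <= B} -> size s <= #|B|.
Proof. by move=> /card_uniqP <- ?; apply/subset_leq_card/subsetP. Qed.

(** An asymmetric colour has the three arcs of a walk. For a symmetric one, apply [sym_color_step]
    from two asymmetric neighbours of [p]: either column [q] repeats the colour, or the rows of both
    neighbours supply a further cell. *)
Lemma color_weight (a : 'I_m) : a \in colors T -> 3 <= #|cells a|.
Proof.
case/imsetP=> -[p q]; rewrite inE /= => /andP[pT qT] /esym pq.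
case: (pickP (fun x => (A x.1 x.2 == a) && (A x.2 x.1 != a))) => [[i j]|no].
  case/andP=> /eqP ij ji; have [l [k [us ss _ _]]] := asym_color_cells ij ji.
  exact: leq_uniq_card us ss.
have a_sym x y : A x y = a -> A y x = a.
  by move=> xy; have := no (x, y); rewrite /= xy eqxx => /negbFE/eqP.
have mem x y : A x y = a -> x \in T -> y \in T -> (x, y) \in cells a.
  by move=> *; exact: mem_cells.
have [i1 [i2 [i12 pi1 pi2]]] := asym_neighbors pT.
have [neq1 neq2] : p != i1 /\ p != i2.
  by split; [apply: contraNneq pi1 => <-|apply: contraNneq pi2 => <-].
have [i1T i2T] := ((mem_asym_support pi1).2, (mem_asym_support pi2).2).
(* Transposition supplies the third cell: [(p, r)] if [p = q], and [(q, p)] otherwise. *)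
have two r : r != p -> A r q = a -> r \in T -> 3 <= #|cells a|.
  move=> rp rq rT.
  case: (eqVneq p q) => [e|npq].
    move: pq rq; rewrite -e => pp rp'.
    apply: (@leq_uniq_card _ [:: (p, p); (r, p); (p, r)]).
      by rewrite /= !inE !xpair_eqE !(eq_sym p r) (negbTE rp) !andbF.
    by move=> x; rewrite !in_cons => /or4P[|||//] /eqP ->; apply: mem => //;
      exact: a_sym.
  apply: (@leq_uniq_card _ [:: (p, q); (r, q); (q, p)]).
    rewrite /= !inE !xpair_eqE !(eq_sym p r) (negbTE rp) (negbTE npq) /=.
    by rewrite (eq_sym q p) (negbTE npq) andbF.
  by move=> x; rewrite !in_cons => /or4P[|||//] /eqP ->; apply: mem => //;
    exact: a_sym.
have ip1 : A i1 p != A p i1 by rewrite eq_sym.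
have [|[k1 [ik1 qk1]]] := sym_color_step a_sym ip1 pq.
  by case=> k [kp ik kq]; exact: (two k kp kq (mem_asym_support ik).2).
have ip2 : A i2 p != A p i2 by rewrite eq_sym.
have [|[k2 [ik2 qk2]]] := sym_color_step a_sym ip2 pq.
  by case=> k [kp ik kq]; exact: (two k kp kq (mem_asym_support ik).2).
apply: (@leq_uniq_card _ [:: (p, q); (i1, k1); (i2, k2)]).
  by rewrite /= !inE !xpair_eqE (negbTE i12) (negbTE neq1) (negbTE neq2).
move=> x; rewrite !in_cons => /or4P[|||//] /eqP ->; apply: mem => //.
- exact: (mem_asym_support qk1).2.
- exact: (mem_asym_support qk2).2.
Qed.

Lemma sum_cells : \sum_(a in colors T) #|cells a| = #|T| ^ 2.
Proof.
rewrite -mulnn -cardsX -sum1_card (partition_big_imset (fun ij => A ij.1 ij.2)).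
by apply: eq_bigr => a _; rewrite -sum1dep_card.
Qed.


(** * Light colours and the sharper count for at least four vertices *)

Lemma sym_outside (i k : 'I_n) : k \notin T -> A i k = A k i.
Proof. by move=> kT; apply: contraNeq kT => /mem_asym_support[]. Qed.

(* Condition (M M^T)_(x,i) = (M^T M)_(x,i), read on the terms containing a. *)
Lemma triangle_apex (a : 'I_m) (i j l x : 'I_n) : j \in T -> l \in T ->
    {in T, forall k, (A x k != a) && (A k x != a)} ->
    {in T, forall k, (A i k == a) = (k == j)} ->
    {in T, forall k, (A k i == a) = (k == l)} ->
  A x j = A l x.
Proof.
move=> jT lT nax row_i col_i.
have := normal_pattern_polar x i (fun c => (c == a)%:R%R)
  (fun c => (c == A x j)%:R%R).
(* Terms outside the support agree on both sides; inside it only [k = j] remains on the left and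
   [k = l] on the right. *)
rewrite (bigID (mem T)) [RHS](bigID (mem T)) /=.
set out := (X in (_ + X)%R); set out' := (X in (_ = _ + X)%R).
have -> : out = out'.
  by apply: eq_bigr => k kT; rewrite !(sym_outside _ kT).
move/addIr; rewrite (bigD1 j) //= big1 => [|k /andP[kT nk]]; last first.
  have /andP[xk kx] := nax k kT.
  by rewrite row_i // (negbTE nk) (negbTE xk) mul0r mulr0 addr0.
rewrite [RHS](bigD1 l) //= [in RHS]big1 => [|k /andP[kT nk]]; last first.
  have /andP[xk kx] := nax k kT.
  by rewrite col_i // (negbTE nk) (negbTE kx) mul0r mulr0 addr0.
have /andP[xj _] := nax j jT; have /andP[_ lx] := nax l lT.
rewrite row_i // col_i // !eqxx (negbTE xj) (negbTE lx).
rewrite !mul0r !mulr1 !add0r !addr0 => /eqP.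
by rewrite Num.Theory.eqr_nat; case: (A l x =P A x j).
Qed.

(** The walk of three arcs already fills [cells a]. Some arc of colour [a] enters [i], and only the
    last arc of the walk can do so, which closes the triangle. *)
Lemma light_asym_color (a : 'I_m) (i j : 'I_n) :
    A i j = a -> A j i != a -> #|cells a| <= 3 ->
  exists l, cells a =i [:: (i, j); (j, l); (l, i)] /\ uniq [:: i; j; l].
Proof.
move=> ij ji le3; have [l [k [us ss li lj]]] := asym_color_cells ij ji.
have nij : i != j by apply: contraNneq ji => e; rewrite -ij e.
have cellsE : cells a =i [:: (i, j); (j, l); (l, k)].
  have sz : #|[set:: [:: (i, j); (j, l); (l, k)]]| = 3.
    by apply: etrans (card_uniqP us); apply: eq_card => x; rewrite in_set.
  have /eqP <- : [set:: [:: (i, j); (j, l); (l, k)]] == cells a.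
    rewrite eqEcard sz le3 andbT; apply/subsetP=> x; rewrite in_set.
    exact: ss.
  by move=> x; rewrite in_set.
have [h [hi ih]] := arc_prev ij ji.
have hiT : A h i != A i h by rewrite hi eq_sym.
have [hT iT] := mem_asym_support hiT.
have := mem_cells hT iT hi; rewrite cellsE !inE !xpair_eqE.
rewrite (negbTE nij) (eq_sym i l) (negbTE li) !andbF /= => /andP[_ /eqP ki].
exists l; rewrite {2}ki; split=> //=.
by rewrite !inE (negbTE nij) (eq_sym i l) (eq_sym j l) (negbTE li) (negbTE lj).
Qed.

(** With only three cells, asymmetry of either arc in colour [b] would make [b] a directed triangle
    through [(j, l)]. Hence both arcs are symmetric, and that gives four cells. *)
Lemma path_color_weight (b : 'I_m) (x j l : 'I_n) :
    x \in T -> j \in T -> l \in T -> uniq [:: x; j; l] ->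
    A x j = b -> A l x = b -> A j l != b ->
  4 <= #|cells b|.
Proof.
move=> xT jT lT; rewrite /= !inE negb_or => /and3P[/andP[xj xl] jl _].
move=> xjb lxb jlb; rewrite leqNgt; apply/negP; rewrite ltnS => le3.
have jxb : A j x = b.
  apply/eqP; apply: contraNT jlb => jxb.
  have [h [cE _]] := light_asym_color xjb jxb le3.
  have jhb : (j, h) \in cells b by rewrite cE !inE eqxx orbT.
  have := mem_cells lT xT lxb; rewrite cE !inE !xpair_eqE.
  rewrite (eq_sym l x) (negbTE xl) (eq_sym l j) (negbTE jl) /=.
  case/andP=> /eqP -> _.
  by move: jhb; rewrite inE => /andP[].
have xlb : A x l = b.
  apply/eqP; apply: contraNT jlb => xlb.
  have [h [cE _]] := light_asym_color lxb xlb le3.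
  have hlb : (h, l) \in cells b by rewrite cE !inE eqxx !orbT.
  have := mem_cells xT jT xjb; rewrite cE !inE !xpair_eqE.
  rewrite (negbTE xl) (negbTE jl) !andbF orbF eqxx /= => /eqP ->.
  by move: hlb; rewrite inE => /andP[].
have : size [:: (x, j); (j, x); (l, x); (x, l)] <= #|cells b|.
  apply: leq_uniq_card => [|y].
    rewrite /= !inE !xpair_eqE (eq_sym j x) (eq_sym l x) (negbTE xj).
    by rewrite (negbTE xl) (negbTE jl) !andbF.
  by rewrite !in_cons => /or4P[|||/orP[|//]] /eqP ->; exact: mem_cells.
by rewrite leqNgt ltnS le3.
Qed.

Lemma color_excess :
  \sum_(a in colors T) (#|cells a| - 3) + 3 * #|colors T| = #|T| ^ 2.
Proof.
rewrite -sum_cells mulnC -sum_nat_const -big_split /=.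
by apply: eq_bigr => a /color_weight/subnK.
Qed.

Lemma mem_colors (U : {set 'I_n}) (i j : 'I_n) :
  i \in U -> j \in U -> A i j \in colors U.
Proof.
by move=> iU jU; apply/imsetP; exists (i, j) => //; rewrite inE iU jU.
Qed.

(** If the total excess over weight 3 were at most 1, at most one colour would be heavy. Some
    asymmetric colour is then a directed triangle, and a fourth vertex [x] of the support produces a
    colour that is too heavy. *)
Lemma card_asym_colors : 4 <= #|T| -> 3 * #|colors T| + 2 <= #|T| ^ 2.
Proof.
move=> T4; rewrite -color_excess addnC leq_add2r leqNgt; apply/negP=> exc.
have heavy a b : a \in colors T -> b \in colors T ->
    4 <= #|cells a| -> 4 <= #|cells b| -> a = b.
  move=> aT bT a4 b4; apply/eqP; apply: contraTT exc => nab.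
  rewrite (bigD1 a) //= (bigD1 b) /=; last by rewrite bT eq_sym.
  rewrite -leqNgt addnA; apply: leq_trans (leq_addr _ _).
  by apply: (@leq_add 1 1); rewrite subn_gt0.
have [i [j [ij light]]] : exists i j, A i j != A j i /\ #|cells (A i j)| <= 3.
  have /card_gt0P[i iT] : 0 < #|T| by apply: leq_trans T4.
  have [j [_ [_ ij _]]] := asym_neighbors iT.
  have [? jT] := mem_asym_support ij.
  case: (leqP #|cells (A i j)| 3) => [?|h1]; first by exists i, j.
  case: (leqP #|cells (A j i)| 3) => [?|h2].
    by exists j, i; rewrite eq_sym.
  by rewrite (heavy _ _ _ _ h1 h2) ?eqxx ?mem_colors in ij.
have ji : A j i != A i j by rewrite eq_sym.
have [l [cE]] := light_asym_color erefl ji light.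
move: cE; set a := A i j => cE.
rewrite /= !inE negb_or => /and3P[/andP[nij nil] njl _].
have [iT jT] := mem_asym_support ij.
have aE x y : x \in T -> y \in T ->
    (A x y == a) = ((x, y) \in [:: (i, j); (j, l); (l, i)]).
  by move=> xT yT; rewrite -cE 2!inE /= xT yT.
have lT : l \in T.
  have : (j, l) \in cells a by rewrite cE !inE eqxx orbT.
  by rewrite 2!inE => /andP[/andP[_ lT] _].
have [x xT] : exists2 x, x \in T & x \notin [set i; j; l].
  apply/subsetPn; apply: contraTN T4 => /subset_leq_card h.
  rewrite -ltnNge ltnS (leq_trans h) // (leq_trans (leq_card_setU _ _)) //.
  by rewrite cards1 cards2; case: eqP.
rewrite !inE !negb_or -andbA => /and3P[xi xj xl].
have distinct := (negbTE nij, negbTE nil, negbTE njl, negbTE xi, negbTE xj,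
  negbTE xl).
have sE := (eq_sym j i, eq_sym l i, eq_sym l j,
  eq_sym i x, eq_sym j x, eq_sym l x).
have nax : {in T, forall k, (A x k != a) && (A k x != a)}.
  by move=> k kT; rewrite !aE // !inE !xpair_eqE ?sE ?distinct ?andbF.
(* Around the directed triangle i, j, l of colour a, normality ties the three
   pairs of arcs joining it to x. *)
have e1 : A x j = A l x.
  by apply: (triangle_apex (a := a) (i := i)) => // k kT;
    rewrite aE // !inE !xpair_eqE ?sE ?distinct ?eqxx ?andbF ?andbT ?orbF.
have e2 : A x l = A i x.
  by apply: (triangle_apex (a := a) (i := j)) => // k kT;
    rewrite aE // !inE !xpair_eqE ?sE ?distinct ?eqxx ?andbF ?andbT ?orbF.
have e3 : A x i = A j x.
  by apply: (triangle_apex (a := a) (i := l)) => // k kT;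
    rewrite aE // !inE !xpair_eqE ?sE ?distinct ?eqxx ?andbF ?andbT ?orbF.
have tri y z : (y, z) \in cells a -> A y z = a.
  by rewrite inE => /andP[_ /eqP].
have [jl li] : A j l = a /\ A l i = a.
  by split; apply: tri; rewrite cE !inE eqxx ?orbT.
have naxl k : k \in T -> a != A x k by move=> /nax; rewrite eq_sym => /andP[].
have h1 : 4 <= #|cells (A x j)|.
  by apply: (path_color_weight (x := x) (j := j) (l := l)) => //;
    rewrite ?jl ?naxl //= !inE ?distinct.
have h2 : 4 <= #|cells (A x l)|.
  by apply: (path_color_weight (x := x) (j := l) (l := i)) => //;
    rewrite ?li ?naxl //= !inE ?sE ?distinct.
have h3 : 4 <= #|cells (A x i)|.
  by apply: (path_color_weight (x := x) (j := i) (l := j)) => //;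
    rewrite ?naxl //= !inE ?sE ?distinct.
(* The single heavy colour occupies all six arcs between [x] and the triangle, so its excess is at
   least 3. *)
have e12 := heavy _ _ (mem_colors xT jT) (mem_colors xT lT) h1 h2.
have e13 := heavy _ _ (mem_colors xT jT) (mem_colors xT iT) h1 h3.
have : size [:: (x, i); (x, j); (x, l); (i, x); (j, x); (l, x)] <=
    #|cells (A x j)|.
  apply: leq_uniq_card => [|y].
    by rewrite /= !inE !xpair_eqE ?sE ?distinct ?andbF.
  rewrite !in_cons => /or4P[|||/or4P[|||//]] /eqP ->; apply: mem_cells => //.
  - by rewrite -e2.
  - by rewrite -e3.
move=> /= c6; move: exc; rewrite (bigD1 (A x j)) ?mem_colors //=.
by rewrite ltnNge; lia.
Qed.

(** * Colours contributed by vertices outside the support *)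

Definition new_colors (q : 'I_n) : {set 'I_m} :=
  [set A q k | k in T] :\: colors T.

(** A colour absent from the block on the support is symmetric, since asymmetric pairs lie in that
    block. The second outcome of [sym_color_step] would place [q] in the support. *)
Lemma new_color_repeat (q i k : 'I_n) :
    q \notin T -> A q k \notin colors T -> A i k != A k i ->
  exists k', [/\ k' != k, A i k' != A k' i & A q k' = A q k].
Proof.
move=> qT new ik.
have a_sym x y : A x y = A q k -> A y x = A q k.
  move=> xy; apply/eqP; apply: contraNT new => yx; rewrite -xy in yx *.
  have [xT yT] : (x \in T) * (y \in T).
    by apply: mem_asym_support; rewrite eq_sym.
  exact: mem_colors.
have [[k' [k'k ik' k'q]]|[k' [_]]] :=
  sym_color_step a_sym ik (sym_outside k qT).
  by exists k'; rewrite -(sym_outside k' qT).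
by move/mem_asym_support=> [qT' _]; rewrite qT' in qT.
Qed.

Lemma card_new_colors (q : 'I_n) : q \notin T -> 2 * #|new_colors q| <= #|T|.
Proof.
move=> qT; rewrite -[#|T|]sum1_card (partition_big_imset (A q)) /=.
rewrite (big_setID (colors T)) /= -/(new_colors q).
apply: leq_trans (leq_addl _ _); rewrite mulnC -sum_nat_const.
apply: leq_sum => a; rewrite !inE => /andP[new /imsetP[k kT aE]].
move: new; rewrite {a}aE => new.
have [i [_ [_ ki _]]] := asym_neighbors kT.
have ik : A i k != A k i by rewrite eq_sym.
have [k' [k'k ik' e]] := new_color_repeat qT new ik.
have [_ k'T] := mem_asym_support ik'.
by rewrite (bigD1 k) ?kT ?eqxx //= (bigD1 k') ?k'T ?e ?eqxx.
Qed.

(** Row and column [q] agree, as [q] is outside the support. The added terms bound the colours of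
    row [q] over [U :\: T], on the diagonal, and new over [T]. *)
Lemma card_colorsU1 (U : {set 'I_n}) (q : 'I_n) : T \subset U -> q \notin U ->
  #|colors (q |: U)| <= #|colors U| + (#|U| - #|T|) + 1 + #|new_colors q|.
Proof.
move=> TU qU; have qT : q \notin T by apply: contra qU; apply: (subsetP TU).
have cardD : #|U| - #|T| = #|U :\: T| by rewrite cardsD (setIidPr TU).
pose D := colors U :|: [set A q k | k in U :\: T] :|: [set A q q]
  :|: new_colors q.
apply: (@leq_trans #|D|); last first.
  do 3![rewrite (leq_trans (leq_card_setU _ _)) ?leq_add ?cards1 //].
  by rewrite cardD leq_imset_card.
have qkD k : k \in q |: U -> A q k \in D.
  rewrite in_setU1 => /orP[/eqP ->|kU].
    by apply/setUP; left; apply/setUP; right; rewrite in_set1.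
  case: (boolP (k \in T)) => kT; last first.
    apply/setUP; left; apply/setUP; left; apply/setUP; right.
    by apply: imset_f; rewrite in_setD kT.
  case: (boolP (A q k \in colors T)) => [/imsetP[[x y]]|new].
    rewrite in_setX => /andP[xT yT] ->; do 3![apply/setUP; left].
    by apply: mem_colors; exact: (subsetP TU).
  by apply/setUP; right; rewrite in_setD new imset_f.
apply: subset_leq_card; apply/subsetP=> a /imsetP[[x y]].
rewrite in_setX /= => /andP[xqU yqU] ->.
have [xq|xq] := eqVneq x q; first by rewrite xq qkD.
have [yq|yq] := eqVneq y q; first by rewrite yq sym_outside // qkD.
move: xqU yqU; rewrite !in_setU1 (negbTE xq) (negbTE yq) /= => xU yU.
by do 3![apply/setUP; left]; exact: mem_colors.
Qed.

End NormalPattern.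

(** * The extremal count, its growth and the case of equality *)

Definition max_colors (t : nat) : nat := t * (t - 3) %/ 2 + 3.

Lemma max_colorsS (t : nat) : 3 <= t ->
  max_colors t.+1 = max_colors t + (t - 1).
Proof.
move=> t3; rewrite /max_colors.
have -> : t.+1 * (t.+1 - 3) = (t - 1) * 2 + t * (t - 3) by nia.
by rewrite divnMDl //; lia.
Qed.

Section Extremal.

Context (R : realType) (m n : nat) (A : entry_pattern m n).
Hypotheses (hnorm : normal_pattern R A) (hns : nonsymmetric A).

Local Notation T := (asym_support A).

Lemma card_asym_support : 3 <= #|T|.
Proof.
have [i [j ij]] : exists i j, A i j != A j i.
  case: (pickP (fun ij => A ij.1 ij.2 != A ij.2 ij.1)) => [[i j] ij|no].
    by exists i, j.
  case: hns; apply/matrixP=> i j; rewrite mxE; apply/eqP.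
  exact: negbFE (no (i, j)).
have [iT _] := mem_asym_support ij.
have [k1 [k2 [k12 ik1 ik2]]] := asym_neighbors hnorm iT.
apply: (@leq_uniq_card _ [:: i; k1; k2]).
  rewrite /= !inE k12 negb_or andbT andbT; apply/andP.
  by split; [apply: contraNneq ik1 => <-|apply: contraNneq ik2 => <-].
move=> x; rewrite !in_cons => /or4P[|||//] /eqP -> //.
- exact: (mem_asym_support ik1).2.
- exact: (mem_asym_support ik2).2.
Qed.

(** Vertices of [W :\: U] are removed one at a time. Each step fits the increment of [max_colorsS],
    because [2 * c <= t] forces [c <= t - 2] once [t >= 3]. *)
Lemma card_colors_growth (U W : {set 'I_n}) : T \subset U -> U \subset W ->
  #|colors A W| + max_colors #|U| <= #|colors A U| + max_colors #|W|.
Proof.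
move=> TU; have [k] := ubnP #|W :\: U|; elim: k W => // k IH W Wk UW.
case: (eqVneq (W :\: U) set0) => [/eqP|/set0Pn[q qWU]].
  by rewrite setD_eq0 => WU; have /eqP -> : W == U by rewrite eqEsubset WU.
have /setDP[qW qU] := qWU.
have UWq : U \subset W :\ q.
  apply/subsetP=> x xU; rewrite !inE (subsetP UW) // andbT.
  by apply: contraNneq qU => <-.
have cW : #|W| = #|W :\ q|.+1 by rewrite (cardsD1 q) qW.
have cWU : #|(W :\ q) :\: U| < k.
  rewrite ltnS in Wk; apply: leq_trans Wk; apply: proper_card.
  apply/properP; split; last by exists q; rewrite // !inE eqxx andbF.
  by apply/subsetP=> x; rewrite !inE => /and3P[-> _ ->].
have {IH}:= IH _ cWU UWq.
have TW : T \subset W :\ q := subset_trans TU UWq.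
have qT : q \notin T by apply: contra qU; apply: (subsetP TU).
have := card_colorsU1 TW (negbT (setD11 q W)); rewrite setD1K //.
have := card_new_colors hnorm qT; have T3 := card_asym_support.
have := subset_leq_card TW; rewrite cW max_colorsS; first by lia.
by rewrite (leq_trans T3) ?subset_leq_card.
Qed.

Lemma card_colors_support : #|colors A T| <= max_colors #|T| ?= iff
  (#|T| == 3) && (#|colors A T| == 3).
Proof.
have T3 := card_asym_support; rewrite /max_colors.
case: (eqVneq #|T| 3) => [T3e|nT3] /=.
  have := color_excess hnorm; rewrite T3e => e.
  have k3 : 3 * #|colors A T| <= 3 * 3 by rewrite -[3 * 3]/(3 ^ 2) -e leq_addl.
  by split => //; move: k3; rewrite leq_pmul2l.
have T4 : 4 <= #|T| by rewrite ltn_neqAle eq_sym nT3.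
have := card_asym_colors hnorm T4; move: T4 {T3 nT3}.
move: #|T| #|colors A T| => t k t4 le.
have lt : k * 2 < (t * (t - 3) %/ 2 + 3) * 2.
  have h : t * (t - 3) + t * 3 = t * t by rewrite -mulnDr subnK // ltnW.
  have ev : ~~ odd (t * (t - 3)).
    by rewrite oddM oddB ?(ltnW t4) //=; case: (odd t).
  rewrite mulnDl divn2 (muln2 _./2) even_halfK //; rewrite -mulnn in le.
  (* This is [(t - 4)(t - 5) >= 0]. The plain bound [3 * k <= t ^ 2] would still permit equality for
     [t = 4, 5, 6]. *)
  have sq : 9 * t <= t * t + 20.
    by case: (leqP 5 t) => [/subnK <-|t5]; [|have -> : t = 4]; nia.
  by nia.
by rewrite ltn_pmul2r // in lt; split; [exact: ltnW|rewrite ltn_eqF].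
Qed.

(** On three vertices an asymmetric colour can continue in one way only, so the colours of
    [(t0, t1)] and [(t1, t0)] run round the triangle in opposite directions. The third colour has
    weight at least 3 and no off-diagonal cell, so it fills the diagonal. *)
Lemma asym_support_triangle : #|T| = 3 -> #|colors A T| = 3 ->
  exists t0 t1 t2, [/\ uniq [:: t0; t1; t2], T =i [:: t0; t1; t2],
    (A t1 t2 = A t0 t1) * (A t2 t0 = A t0 t1) *
    (A t1 t0 = A t0 t2) * (A t2 t1 = A t0 t2) &
    (A t0 t1 != A t0 t2) * (A t1 t1 = A t0 t0) * (A t2 t2 = A t0 t0)].
Proof.
move=> T3 k3.
have /card_gt0P[t0 t0T] : 0 < #|T| by rewrite T3.
have [t1 [_ [_ t01 _]]] := asym_neighbors hnorm t0T.
have [_ t1T] := mem_asym_support t01.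
have t10 : A t1 t0 != A t0 t1 by rewrite eq_sym.
have asymN x y : A x y != A y x -> x != y by apply: contraNneq => ->.
have [t2 [e12 t21]] := arc_next hnorm erefl t10.
have t12 : A t1 t2 != A t2 t1 by rewrite e12 eq_sym.
have [_ t2T] := mem_asym_support t12.
have n02 : t0 != t2 by apply: contraNneq t10 => e; rewrite [in A t1 t0]e e12.
have n01 := asymN _ _ t01; have n12 := asymN _ _ t12.
have us : uniq [:: t0; t1; t2] by rewrite /= !inE negb_or n01 n02 n12.
have TE : T =i [:: t0; t1; t2].
  move=> x; have -> : T = [set:: [:: t0; t1; t2]].
    apply/esym/eqP; rewrite eqEcard T3; apply/andP; split; last first.
      rewrite (_ : #|_| = size [:: t0; t1; t2]) // -(card_uniqP us).
      by apply: eq_card => y; rewrite in_set.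
    by apply/subsetP=> y; rewrite in_set !in_cons => /or4P[|||//] /eqP ->.
  by rewrite in_set.
have third x y z k : x \in T -> y \in T -> z \in T -> A x k != A k x ->
    x != y -> z != x -> z != y -> k != y -> k = z.
  move=> xT yT zT xk; have [_ kT] := mem_asym_support xk.
  move: (asymN _ _ xk); move: xT yT zT kT; rewrite !TE !inE.
  by do 4![case/or3P => /eqP ->]; rewrite ?eqxx.
have [k [e20 k2]] := arc_next hnorm e12 t21.
have nk1 : k != t1 by apply: contraNneq t21 => e; rewrite -{1}e e20.
have kE : k = t0 by apply: (third t2 t1); rewrite // ?e20 eq_sym.
subst k => {nk1}.
have [k [e02 kk]] := arc_next hnorm (erefl (A t1 t0)) t01.
have nk1 : k != t1 by apply: contraNneq kk => ->.
have kE : k = t2 by apply: (third t0 t1); rewrite // ?e02 eq_sym.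
subst k => {nk1}.
have [k [e21 kk']] := arc_next hnorm e02 kk.
have nk0 : k != t0 by apply: contraNneq kk => e; rewrite -{1}e e21.
have kE : k = t1 by apply: (third t2 t0); rewrite // ?e21 eq_sym.
subst k => {nk0}.
have [z zT zuv] : exists2 z, z \in colors A T & z \notin [set A t0 t1; A t1 t0].
  apply/subsetPn; apply: contra_eqN k3 => /subset_leq_card.
  by rewrite cards2 t01 => h; rewrite ltn_eqF.
have offdiag x y : x \in T -> y \in T -> A x y = z -> x = y.
  move=> xT yT xy; move: zuv; rewrite -xy !inE.
  move: xT yT; rewrite !TE !inE => /or3P[] /eqP -> /or3P[] /eqP -> //;
  by rewrite ?e12 ?e20 ?e02 ?e21 ?eqxx ?orbT.
have diag : cells A z = [set (x, x) | x in T].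
  apply/eqP; rewrite eqEcard; apply/andP; split; last first.
    by rewrite card_imset ?T3 ?(color_weight hnorm zT) // => x y [].
  apply/subsetP=> -[x y]; rewrite 2!inE /= => /andP[/andP[xT yT] /eqP xy].
  by apply/imsetP; exists x => //; rewrite (offdiag x y).
have loop x : x \in T -> A x x = z.
  move=> xT.
  have : (x, x) \in cells A z by rewrite diag; apply/imsetP; exists x.
  by rewrite 2!inE => /andP[_ /eqP].
exists t0, t1, t2; split=> //.
  by rewrite e12 e20 e02 e21.
by rewrite e02 t01 !loop.
Qed.

Lemma extremal_structure : #|colors A setT| = max_colors n ->
  exists t0 t1 t2, [/\ uniq [:: t0; t1; t2],
    (A t1 t2 = A t0 t1) * (A t2 t0 = A t0 t1) *
    (A t1 t0 = A t0 t2) * (A t2 t1 = A t0 t2),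
    (A t1 t1 = A t0 t0) * (A t2 t2 = A t0 t0) &
    forall q, q \notin [:: t0; t1; t2] ->
      [/\ A q t1 = A q t0, A q t2 = A q t0 & forall r, A r q = A q r]].
Proof.
move=> kE; have [kT_le kT_eq] := card_colors_support.
have := card_colors_growth (subxx T) (subsetT T).
rewrite kE cardsT card_ord addnC leq_add2r => kT_ge.
have kT : #|colors A T| = max_colors #|T| by apply/eqP; rewrite eqn_leq kT_le.
have /andP[/eqP T3 /eqP k3] : (#|T| == 3) && (#|colors A T| == 3).
  by rewrite -kT_eq kT.
have [t0 [t1 [t2 [us TE arcs [[n01 l1] l2]]]]] := asym_support_triangle T3 k3.
exists t0, t1, t2; split=> // q; rewrite -TE => qT.
(* Take [q] as the last vertex added: without a new colour over the support, the total would fall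
   short of [max_colors n]. *)
have [a] : exists a, a \in new_colors A q.
  apply/set0Pn/eqP => no; have := card_colorsU1 (U := setT :\ q) (A := A).
  have TU : T \subset setT :\ q.
    by apply/subsetP=> x xT; rewrite !inE andbT; apply: contraNneq qT => <-.
  have nE : n = #|[set: 'I_n] :\ q|.+1.
    by rewrite -[LHS]card_ord -cardsT (cardsD1 q) inE.
  move=> /(_ q TU); rewrite setD11 setD1K ?inE // no cards0 kE => /(_ isT).
  have := card_colors_growth (subxx T) TU; rewrite kT addnC leq_add2l.
  have := subset_leq_card TU; rewrite T3 => U3.
  have -> : max_colors n = max_colors #|setT :\ q| + (#|setT :\ q| - 1).
    by rewrite [in LHS]nE max_colorsS.
  move: #|colors _ _| U3 => ?; set c := #|_ :\ q|.
  by move: c (max_colors c) => ? ?; lia.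
rewrite in_setD => /andP[new /imsetP[k kT' aE]]; rewrite {a}aE in new.
(* Let [i] be the vertex of the triangle other than [k] and [k']. The repetition seen from [i]
   avoids both [i] and [k], so it occurs at [k']. *)
have all_eq k' : k' \in T -> A q k' = A q k.
  move=> k'T; have [->//|k'k] := eqVneq k' k.
  have [i [iT ik ik']] : exists i, [/\ i \in T, i != k & i != k'].
    have : 0 < #|T :\ k :\ k'|.
      have := cardsD1 k T.
      rewrite T3 kT' (cardsD1 k' (T :\ k)) in_setD1 k'k k'T.
      by case: #|_|.
    case/card_gt0P=> i; rewrite !in_setD1 => /and3P[ik' ik iT].
    by exists i.
  have asymT x y : x \in T -> y \in T -> x != y -> A x y != A y x.
    rewrite !TE !inE => /or3P[] /eqP -> /or3P[] /eqP -> //;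
      by rewrite ?eqxx //= => _; rewrite ?arcs // eq_sym.
  have [j [jk ij <-]] := new_color_repeat hnorm qT new (asymT _ _ iT kT' ik).
  have [_ jT] := mem_asym_support ij.
  have ji : j != i by apply: contraNneq ij => ->.
  suff -> : k' = j by [].
  move: ik ik' k'k jk ji; move: iT k'T kT' jT; rewrite !TE !inE.
  by do 4![case/or3P => /eqP ->]; rewrite ?eqxx.
have T012 : [/\ t0 \in T, t1 \in T & t2 \in T] by rewrite !TE !inE !eqxx !orbT.
case: T012 => t0T t1T t2T; rewrite !all_eq //; split=> // r.
exact: sym_outside.
Qed.

End Extremal.

(** * Counting the extremal form and recovering it up to permutation *)

Lemma card_leq_pairs (p : nat) :
  #|[pred ij : 'I_p * 'I_p | (ij.1 <= ij.2)%N]| * 2 = p * p.+1.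
Proof.
rewrite -sum1_card.
rewrite -(pair_big_dep xpredT (fun i j : 'I_p => i <= j) (fun _ _ => 1)).
rewrite /= (exchange_big_dep xpredT) //=.
under eq_bigr => j _ do
  rewrite -(big_ord_widen p (fun=> 1) (ltn_ord j)) sum_nat_const card_ord muln1.
elim: p => [|p IH]; first by rewrite big_ord0.
by rewrite big_ord_recr /= mulnDl IH; nia.
Qed.

(** The summands count [u, v, z], then the [y i], then the [x i j] with [i <= j]. *)
Lemma max_colorsD3 (p : nat) : max_colors (p + 3) =
  3 + p + #|[pred ij : 'I_p * 'I_p | (ij.1 <= ij.2)%N]|.
Proof.
rewrite /max_colors addnK; have := card_leq_pairs p.
set c := #|_| => cE; have -> : (p + 3) * p = (p + c) * 2.
  by rewrite [RHS]mulnDl cE; nia.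
by rewrite mulnK //; lia.
Qed.

Lemma num_entries_colors (m n : nat) (A : entry_pattern m n) :
  num_entries A = #|colors A setT|.
Proof.
apply: eq_card => a; apply/imsetP/imsetP => -[ij _ ->]; exists ij => //.
by rewrite !inE.
Qed.

Lemma perm_conjEE (T : Type) (n : nat) (s : 'S_n) (A : 'M[T]_n) (i j : 'I_n) :
  perm_conj s A i j = A ((s^-1)%g i) ((s^-1)%g j).
Proof. by rewrite !mxE. Qed.

Lemma size_extremal_entries (m p : nat) (x : 'I_p -> 'I_p -> 'I_m)
    (y : 'I_p -> 'I_m) (z u v : 'I_m) :
  size ([:: u; v; z] ++ [seq y i | i : 'I_p] ++
    [seq x ij.1 ij.2 | ij in [pred ij : 'I_p * 'I_p | (ij.1 <= ij.2)%N]])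
  = max_colors (p + 3).
Proof.
by rewrite !size_cat !size_image card_ord max_colorsD3 addnA.
Qed.

(** The listed indeterminates are distinct and each occurs in [B]; the reverse inequality comes from
    the general bound. *)
Lemma extremal_form_num_entries (m n : nat) (B : entry_pattern m n) :
  extremal_form B -> max_colors n <= num_entries B.
Proof.
case=> p [e [x [y [z [u [v [us BE]]]]]]]; subst n.
rewrite castmx_id in BE; rewrite -(size_extremal_entries x y z u v).
rewrite num_entries_colors; apply: (leq_uniq_card us) => c.
have in_colors i j : B i j = c -> c \in colors B setT.
  by move=> <-; apply: mem_colors; rewrite inE.
pose r k (lt_k3 : k < 3) := rshift p (Ordinal lt_k3).
rewrite !mem_cat => /or3P[].
- rewrite !inE => /or3P[] /eqP cE; rewrite cE in in_colors *.
  + apply: (in_colors (r 0 isT) (r 1 isT)).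
    by rewrite BE block_mxEdr mxE.
  + apply: (in_colors (r 0 isT) (r 2 isT)).
    by rewrite BE block_mxEdr mxE.
  + apply: (in_colors (r 0 isT) (r 0 isT)).
    by rewrite BE block_mxEdr mxE.
- case/imageP=> i _ cE.
  apply: (in_colors (lshift 3 i) (r 0 isT)).
  by rewrite BE block_mxEur mxE.
- case/imageP=> -[i j] ij cE; apply: (in_colors (lshift 3 i) (lshift 3 j)).
  by rewrite BE block_mxEul mxE (ij : i <= j) cE.
Qed.

Lemma perm_similar_num_entries (m n : nat) (A B : entry_pattern m n) :
  perm_similar A B -> num_entries B = num_entries A.
Proof.
case=> s ->; apply: eq_card => a; apply/imsetP/imsetP => -[[i j] _ ->] /=.
  by exists ((s^-1)%g i, (s^-1)%g j); rewrite ?perm_conjEE.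
by exists (s i, s j); rewrite //= perm_conjEE !permK.
Qed.

Lemma extremal_similar (R : realType) (m n : nat) (A : entry_pattern m n) :
    3 <= n -> normal_pattern R A -> nonsymmetric A ->
    num_entries A = max_colors n ->
  exists B : entry_pattern m n, perm_similar A B /\ extremal_form B.
Proof.
move=> n3 hnorm hns kE.
have := extremal_structure hnorm hns; rewrite -num_entries_colors => /(_ kE).
case=> t0 [t1 [t2 [us arcs loops out]]].
have [p nE] : exists p, p + 3 = n by exists (n - 3); rewrite subnK.
subst n.
(* Vertices outside the triangle come first and [t0, t1, t2] last, so that the circulant lands in
   the lower right block. *)
pose s0 := [seq q <- enum 'I_(p + 3) | q \notin [:: t0; t1; t2]].
pose s := s0 ++ [:: t0; t1; t2].
have s_uniq : uniq s.
  rewrite cat_uniq filter_uniq ?enum_uniq // us andbT.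
  by apply/hasPn=> q q012; rewrite /= mem_filter q012.
have s_full : s =i enum 'I_(p + 3).
  by move=> q; rewrite mem_cat mem_filter mem_enum andbT orNb.
have s_size : size s = p + 3.
  by rewrite (perm_size (uniq_perm s_uniq (enum_uniq _) s_full)) size_enum_ord.
have s0_size : size s0 = p.
  by move: s_size; rewrite size_cat => /addIn.
pose g (i : 'I_(p + 3)) := nth t0 s i.
have g_inj : injective g.
  move=> i j /eqP; rewrite nth_uniq ?s_size // => /eqP; exact: val_inj.
have g_out i : g (lshift 3 i) \notin [:: t0; t1; t2].
  rewrite /g nth_cat s0_size /= ltn_ord.
  have /(mem_nth t0) : i < size s0 by rewrite s0_size.
  by rewrite mem_filter => /andP[].
have g_in (i : 'I_3) : g (rshift p i) = nth t0 [:: t0; t1; t2] i.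
  by rewrite /g nth_cat s0_size /= ltnNge leq_addr /= addKn.
pose sg := (perm g_inj)^-1%g.
exists (perm_conj sg A); split; first by exists sg.
have BE i j : perm_conj sg A i j = A (g i) (g j).
  by rewrite perm_conjEE invgK !permE.
pose x i j := A (g (lshift 3 i)) (g (lshift 3 j)).
pose y i := A (g (lshift 3 i)) t0.
have xC i j : x i j = x j i.
  by rewrite /x; have [_ _ ->] := out _ (g_out i).
exists p, erefl, x, y, (A t0 t0), (A t0 t1), (A t0 t2).
have BE' : perm_conj sg A = extremal_block x y (A t0 t0) (A t0 t1) (A t0 t2).
  apply/matrixP=> i j; rewrite BE -[i]splitK -[j]splitK.
  case: (split i) (split j) => {}i [] {}j /=.
  - by rewrite block_mxEul mxE -/(x i j) (xC j i) if_same.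
  - rewrite block_mxEur mxE g_in; have [e1 e2 _] := out _ (g_out i).
    by case: j => [[|[|[|]]]].
  - rewrite block_mxEdl mxE g_in; have [e1 e2 eC] := out _ (g_out j).
    rewrite eC; by case: i => [[|[|[|]]]].
  - rewrite block_mxEdr mxE !g_in.
    by case: i => [[|[|[|]]]] //= ?; case: j => [[|[|[|]]]] //= ?;
      rewrite ?arcs ?loops.
split; last by rewrite castmx_id.
(* Distinctness by counting: the list covers all [max_colors (p + 3)] colours and has exactly that
   length. *)
apply: (leq_size_uniq (enum_uniq (colors (perm_conj sg A) setT))); last first.
  rewrite size_extremal_entries -cardE -num_entries_colors -kE.
  by rewrite (@perm_similar_num_entries _ _ A) //; exists sg.
move=> c; rewrite mem_enum BE' => /imsetP[[i j] _ ->].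
rewrite !mem_cat /= -[i]splitK -[j]splitK.
case: (split i) (split j) => {}i [] {}j /=.
- rewrite block_mxEul mxE; apply/or3P/Or33; case: leqP => [ij|/ltnW ij].
    by apply/imageP; exists (i, j).
  by apply/imageP; exists (j, i).
- by rewrite block_mxEur mxE image_f ?orbT.
- by rewrite block_mxEdl mxE image_f ?orbT.
- rewrite block_mxEdr mxE !inE.
  by case: i => [[|[|[|]]]] //= ?; case: j => [[|[|[|]]]] //= ?;
    rewrite eqxx ?orbT.
Qed.

Theorem theorem1 (R : realType) (m n : nat) (hn : 3 <= n)
    (A : entry_pattern m n) (hns : nonsymmetric A) (hnorm : normal_pattern R A) :
  num_entries A <= n * (n - 3) %/ 2 + 3 /\
  (num_entries A = n * (n - 3) %/ 2 + 3 <->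
   exists B : entry_pattern m n, perm_similar A B /\ extremal_form B).
Proof.
(* Growth from the support to the whole vertex set carries the bound over. *)
have le : num_entries A <= max_colors n.
  have := card_colors_growth hnorm hns (subxx _) (subsetT _).
  have := (card_colors_support hnorm hns).1.
  by rewrite num_entries_colors cardsT card_ord; lia.
split=> //; split=> [kE|[B [AB /extremal_form_num_entries Bge]]].
  exact: (extremal_similar hn hnorm hns).
by apply/eqP; rewrite eqn_leq le -(perm_similar_num_entries AB).
Qed.
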